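(* Let $q$ be even, $n\ge 3$, and let $\mathcal{O}$ be a unipotent conjugacy class in $\mathbf{SU}_n(q)$ with partition $\lambda=(2,1^a)$, $a=n-2$. Then $\mathcal{O}$ is austere, hence kthulhu.
   Context: $\mathbf{SU}_n(q)=\mathbf{SL}_n(\Bbbk)^F$, where $\Bbbk=\overline{\mathbb{F}_q}$, $F(X)=\mathtt{J}_n\,{}^t(\mathrm{Fr}_q(X))^{-1}\mathtt{J}_n$, $\mathrm{Fr}_q$ raises matrix entries to the $q$-th power and $\mathtt{J}_n$ is the antidiagonal matrix with all antidiagonal entries $1$. The partition of a unipotent class is the list of Jordan block sizes of its elements. A rack is a non-empty set $X$ with an operation $\triangleright$ such that $x\triangleright(y\triangleright z)=(x\triangleright y)\triangleright(x\triangleright z)$ and each $x\triangleright\underline{\ \ }$ is bijective. A conjugacy class in a group is a rack with $x\triangleright y=xyx^{-1}$. A subrack is a non-empty subset which is a rack under the restricted operation. A rack is abelian if $x\triangleright y=y$ for all $x,y$. A rack $Y$ is decomposable if $Y=R\coprod S$ is a disjoint union of two subracks, and indecomposable otherwise. A rack is austere if every subrack generated by two elements is either abelian or indecomposable. $\mathrm{Inn}\,Y$ is the subgroup of the symmetric group $\mathbb{S}_Y$ generated by the maps $y\triangleright\underline{\ \ }$, $y\in Y$, and $\mathcal{O}_y^{\mathrm{Inn}\,Y}$ is the orbit of $y$ under it. A rack $X$ is of type D if it has a decomposable subrack $Y=R\coprod S$ and $r\in R$, $s\in S$ with $r\triangleright(s\triangleright(r\triangleright s))\ne s$. It is of type F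 if it has subracks $R_1,\dots,R_4$ and $r_a\in R_a$ with $R_a\triangleright R_b=R_b$ for all $a,b$, and $R_a\cap R_b=\emptyset$, $r_a\triangleright r_b\neq r_b$ for $a\ne b$. It is of type C if it has a decomposable subrack $Y=R\coprod S$ and $r\in R$, $s\in S$ with $r\triangleright s\ne s$, $R=\mathcal{O}_r^{\mathrm{Inn}\,Y}$, $S=\mathcal{O}_s^{\mathrm{Inn}\,Y}$, and $\min\{|R|,|S|\}>2$ or $\max\{|R|,|S|\}>4$. A rack is kthulhu if it is of none of the types C, D, F. *)

(* Defs.v *)
From HB Require Import structures.
From mathcomp Require Export all_boot all_order all_algebra.
From mathcomp Require Export boolp classical_sets functions cardinality.

Set Implicit Arguments.
Unset Strict Implicit.
Unset Printing Implicit Defensive.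

Import GRing.Theory.

Local Open Scope classical_set_scope.

(* Racks are represented as sets X inside an ambient type T carrying an
   operation op; only the restriction of op to X matters. *)
Section Racks.
Variables (T : Type) (op : T -> T -> T).
Implicit Types (X Y R S : set T).

Definition is_rack X : Prop :=
  [/\ X !=set0,
      (forall x y z, X x -> X y -> X z ->
         op x (op y z) = op (op x y) (op x z)) &
      (forall x, X x -> set_bij X X (op x))].

Definition subrack X Y : Prop := Y `<=` X /\ is_rack Y.

Definition abelian_rack Y : Prop := forall x y, Y x -> Y y -> op x y = y.

Definition decomposition Y R S : Prop :=
  [/\ subrack Y R, subrack Y S, Y = R `|` S & R `&` S = set0].

Definition decomposable Y : Prop := exists R S, decomposition Y R S.

Definition subrack_gen2 X x y : set T := smallest (subrack X) [set x; y].

Definition austere X : Prop :=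
  is_rack X /\
  forall x y, X x -> X y ->
    abelian_rack (subrack_gen2 X x y) \/ ~ decomposable (subrack_gen2 X x y).

(* A permutation of Y is represented by any map T -> T extending it: Inn Y f
   means that the restriction of f to Y belongs to the subgroup of the symmetric
   group of Y generated by the maps op y, y in Y.  In Inn_inv, f restricts to a
   permutation of Y, so g restricts to its inverse. *)
Inductive Inn Y : (T -> T) -> Prop :=
| Inn_gen y : Y y -> Inn Y (op y)
| Inn_id : Inn Y id
| Inn_comp f g : Inn Y f -> Inn Y g -> Inn Y (f \o g)
| Inn_inv f g : Inn Y f -> (forall z, Y z -> Y (g z) /\ f (g z) = z) -> Inn Y g.

Definition Inn_orbit Y y : set T := [set z | exists2 f, Inn Y f & z = f y].

Definition type_D X : Prop :=
  exists Y R S r s,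
    [/\ subrack X Y, decomposition Y R S, R r, S s &
        op r (op s (op r s)) <> s].

Definition type_F X : Prop :=
  exists (R : 'I_4 -> set T) (r : 'I_4 -> T),
    [/\ (forall a, subrack X (R a)),
        (forall a, R a (r a)),
        (forall a b, [set op x y | x in R a & y in R b] = R b) &
        (forall a b, a != b ->
           R a `&` R b = set0 /\ op (r a) (r b) <> r b)].

(* `I_m #<= A says that A has at least m elements. *)
Definition type_C X : Prop :=
  exists Y R S r s,
    [/\ subrack X Y /\ decomposition Y R S,
        R r /\ S s,
        op r s <> s,
        R = Inn_orbit Y r /\ S = Inn_orbit Y s &
        ((`I_3 #<= R)%card /\ (`I_3 #<= S)%card) \/
        ((`I_5 #<= R)%card \/ (`I_5 #<= S)%card)].

Definition kthulhu X : Prop :=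
  is_rack X /\ [/\ ~ type_C X, ~ type_D X & ~ type_F X].

End Racks.

Local Open Scope ring_scope.

Section Matrices.
Variables (k : fieldType) (n : nat).
Implicit Types (x y g : 'M[k]_n) (G O : set 'M[k]_n).

Definition antidiag_mx : 'M[k]_n := \matrix_(i, j) (j == rev_ord i)%:R.

Definition Frob_mx (q : nat) x : 'M[k]_n := map_mx (fun a => a ^+ q) x.

Definition Steinberg_SU (q : nat) x : 'M[k]_n :=
  antidiag_mx *m (invmx (Frob_mx q x))^T *m antidiag_mx.

Definition SU (q : nat) : set 'M[k]_n :=
  [set x | \det x = 1 /\ Steinberg_SU q x = x].

Definition conj_op x y : 'M[k]_n := x *m y *m invmx x.

Definition conjugacy_class G O : Prop :=
  exists2 x, G x & O = [set conj_op g x | g in G].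

Definition unipotent x : Prop := exists m : nat, (x - 1%:M) ^+ m = 0.

End Matrices.

Definition jordan_block (k : fieldType) (a : k) (m : nat) : 'M[k]_m :=
  \matrix_(i, j) (a *+ (i == j) + (i.+1 == j :> nat)%:R).

Definition unipotent_jordan_mx (k : fieldType) (lam : seq nat) :
    'M[k]_(\sum_(i < size lam) nth 0%N lam i) :=
  \mxdiag_(i < size lam) jordan_block (1 : k) (nth 0%N lam i).

(* The equation e identifies the size \sum_i lam_i of the block matrix with n. *)
Definition has_partition (k : fieldType) (n : nat) (x : 'M[k]_n)
    (lam : seq nat) : Prop :=
  [/\ sorted geq lam, 0%N \notin lam &
      exists (e : (\sum_(i < size lam) nth 0 lam i)%N = n) (P : 'M[k]_n),
        P \in unitmx /\
        x = P *m castmx (e, e) (unipotent_jordan_mx k lam) *m invmx P].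

Definition unipotent_class_with_partition (k : fieldType) (n : nat)
    (G O : set 'M[k]_n) (lam : seq nat) : Prop :=
  conjugacy_class G O /\
  forall x, O x -> unipotent x /\ has_partition x lam.

(* k is an algebraic closure of F, via the embedding iota. *)
Definition is_algebraic_closure (F : fieldType) (k : closedFieldType)
    (iota : {rmorphism F -> k}) : Prop :=
  forall z : k, algebraicOver iota z.

(* Main.v *)
From HB Require Import structures.
Require Import Defs.
From mathcomp Require Import finfield ring.

(* Elements of the class are involutions 1 + A with A of rank one and, since
   x^* = x^-1 = x, self-adjoint for the Hermitian form.  For x = 1 + A and
   y = 1 + B put t = tr(AB).  If t = 0, then AB or BA vanishes, hence both do, as
   (AB)^* = BA; so x and y commute.  If t <> 0, then t^q = t, the nontrivial
   eigenvalues l, 1/l of xy have sum t and are permuted by the q-th power map, so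
   l^(q^2 - 1) = 1 and xy has odd order.  Thus two noncommuting elements generate
   a dihedral group in which they are conjugate, and lie in no two disjoint sets
   stable under conjugation by both; each of the types C, D, F, as well as a
   decomposable nonabelian subrack on two generators, would provide such sets. *)

Set Implicit Arguments.
Unset Strict Implicit.
Unset Printing Implicit Defensive.

Import GRing.Theory.

Local Open Scope classical_set_scope.
Local Open Scope ring_scope.

(** * Racks whose noncommuting elements are linked *)

Section Racks.
Variables (T : Type) (op : T -> T -> T) (X : set T).
Hypothesis rackX : is_rack op X.

Lemma rack_op_inj x y z : X x -> X y -> X z -> op x y = op x z -> y = z.
Proof.
case: rackX => _ _ bX Xx Xy Xz; case: (bX x Xx) => _ + _.
by apply; rewrite inE.
Qed.

Lemma subrack_opP Y x y : subrack op X Y -> Y x -> Y y -> Y (op x y).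
Proof. by case=> _ [_ _ bY] Yx Yy; case: (bY x Yx) => + _ _; apply. Qed.

(** If [y] and [op y r] were both in [S], surjectivity of [op y] on [S] and its injectivity on [X]
    would put [r] in [S]. *)
Lemma decomposition_opl Y R S y r :
    Y `<=` X -> (forall a b, Y a -> Y b -> Y (op a b)) ->
  decomposition op Y R S -> Y y -> R r -> R (op y r).
Proof.
move=> YX opY [[RY rackR] [SY rackS] YE RS0] Yy Rr.
have disj z : R z -> S z -> False.
  by move=> Rz Sz; have : (R `&` S) z by []; rewrite RS0.
have : (R `|` S) y by rewrite -YE.
case=> [Ry|Sy]; first by case: rackR => _ _ /(_ y Ry)[+ _ _]; apply.
have : (R `|` S) (op y r) by rewrite -YE; apply: opY => //; apply: RY.
case=> // Syr; exfalso.
case: rackS => _ _ /(_ y Sy)[_ _ /(_ _ Syr)[s Ss /=]] yE.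
have sr : s = r by apply: rack_op_inj yE; apply: YX => //; [apply: SY|apply: RY].
by apply: (disj r) => //; rewrite -sr.
Qed.

Hypothesis op_id : forall x, X x -> op x x = x.
Hypothesis op_sym : forall x y, X x -> X y -> op x y = y -> op y x = x.
(* Holds when noncommuting [x] and [y] are conjugate in the group they generate. *)
Hypothesis linked : forall x y, X x -> X y -> op x y <> y ->
  forall R : set T, R x -> (forall z, R z -> R (op x z)) ->
  (forall z, R z -> R (op y z)) -> R y.

(** Otherwise [r] and [s] are linked; [R] is stable under both, so it would contain [s]. *)
Lemma decomposition_fixed Y R S r s :
    Y `<=` X -> (forall a b, Y a -> Y b -> Y (op a b)) ->
  decomposition op Y R S -> R r -> S s -> op r s = s.
Proof.
move=> YX opY dY Rr Ss; apply: contrapT => rs.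
have [[RY _] [SY _] _ RS0] := dY.
have Rs : R s.
  apply: (linked _ _ rs Rr) => [||z|z]; try exact/YX/SY; try exact/YX/RY.
    by apply: decomposition_opl dY _ => //; apply: RY.
  by apply: decomposition_opl dY _ => //; apply: SY.
by have : (R `&` S) s by []; rewrite RS0.
Qed.

(** If [x] and [y] commute, the pair is itself a trivial subrack. Otherwise they cannot lie in
    opposite parts of a decomposition, by [decomposition_fixed], nor in the same part, which as a
    subrack containing both generators would be everything. *)
Lemma linked_austere : austere op X.
Proof.
split=> // x y Xx Xy.
have [xy|xy] := pselect (op x y = y).
  left; have yx := op_sym Xx Xy xy.
  have triv a b : [set x; y] a -> [set x; y] b -> op a b = b.
    by move=> [->|->] [->|->] //; apply: op_id.
  suff sub : subrack_gen2 op X x y `<=` [set x; y].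
    by move=> a b /sub ? /sub ?; apply: triv.
  move=> z; apply; split=> //; split; first by move=> a [->|->].
  split; first by exists x; left.
    by move=> a b c pa pb pc; rewrite (triv b c) ?(triv a b) ?(triv a c) ?(triv b c).
  move=> a pa; split.
  - by move=> b pb /=; rewrite triv.
  - by move=> b c /[!inE] pb pc; rewrite !triv.
  - by move=> b pb; exists b => //; rewrite triv.
right; case=> R [S dY].
set Y := subrack_gen2 op X x y in dY.
have Yx : Y x by move=> Z [_]; apply; left.
have Yy : Y y by move=> Z [_]; apply; right.
have YX : Y `<=` X.
  move=> z; apply; split; first by split.
  by move=> a [->|->].
have opY a b : Y a -> Y b -> Y (op a b).
  by move=> Ya Yb Z ZP; apply: (subrack_opP ZP.1); [apply: Ya|apply: Yb].
have [[RY rackR] [SY rackS] YE _] := dY.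
have full Z : Z `<=` Y -> is_rack op Z -> Z x -> Z y -> Y `<=` Z.
  move=> ZY rackZ Zx Zy z; apply; split; last by move=> a [->|->].
  by split=> // ? /ZY/YX.
have fixed := decomposition_fixed YX opY dY.
have disj z : R z -> S z -> False.
  case: dY => _ _ _ RS0 Rz Sz.
  by have : (R `&` S) z by []; rewrite RS0.
have [[r Rr] _ _] := rackR; have [[s Ss] _ _] := rackS.
have [] : (R `|` S) x by rewrite -YE.
all: have [] : (R `|` S) y by rewrite -YE.
- by move=> Ry Rx; apply: (disj s) => //; apply: (full R) => //; apply: SY.
- by move=> Sy Rx; apply: xy; apply: fixed.
- by move=> Ry Sx; apply/xy/op_sym/fixed.
- by move=> Sy Sx; apply: (disj r) => //; apply: (full S) => //; apply: RY.
Qed.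

(** In types C and D, [decomposition_fixed] makes the chosen [r] and [s] commute; for D this gives
    [op r (op s (op r s)) = s]. Type F is refuted with two of its four subracks: [R a] is stable
    under [r a] and [r b], hence contains [r b]. *)
Lemma linked_kthulhu : kthulhu op X.
Proof.
split=> //; split.
- case=> [Y [R [S [r [s [[sY dY] [Rr Ss] rs _ _]]]]]]; apply: rs.
  apply: decomposition_fixed dY Rr Ss; first by case: sY.
  by move=> a b; apply: subrack_opP.
- case=> [Y [R [S [r [s [sY dY Rr Ss rs]]]]]]; apply: rs.
  have YX : Y `<=` X by case: sY.
  have rs : op r s = s.
    by apply: decomposition_fixed dY Rr Ss => // a b; apply: subrack_opP.
  have Xs : X s by case: dY => _ [+ _] _ _; move/(_ s Ss)/YX.
  by rewrite rs op_id.
- case=> [R [r [sR Rr opR dR]]].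
  pose a : 'I_4 := 0; pose b : 'I_4 := 1.
  have [ab0 rab] := dR a b isT.
  have XR c : X (r c) by case: (sR c) => + _; apply.
  have opRP c z : R a z -> R a (op (r c) z).
    by move=> Raz; rewrite -(opR c a); exists (r c) => //; exists z.
  have Rab : R a (r b).
    by apply: (linked (XR a) (XR b) rab (Rr a)) => z; apply: opRP.
  by have : (R a `&` R b) (r b) by []; rewrite ab0.
Qed.

End Racks.

(** * Involutions whose product has odd order *)

Lemma expr_dihedral (A : pzRingType) (x y : A) s :
  x * x = 1 -> y * y = 1 -> (x * y) ^+ s.*2.+1 = 1 ->
  (x * y) ^+ s.*2 * x = y.
Proof.
by move=> xx yy /(congr1 ( *%R^~ y)); rewrite exprSr -mulrA -(mulrA x) yy mulr1 mul1r.
Qed.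

(** Since [x] and [y] are involutions, [(x * y) ^+ s.*2 * x] is [x] conjugated [s] times by [x * y],
    so it stays in [R]; by [expr_dihedral] it equals [y]. *)
Lemma conj_linked (k : fieldType) n (x y : 'M[k]_n.+1) s (R : set 'M[k]_n.+1) :
    x * x = 1 -> y * y = 1 -> (x * y) ^+ s.*2.+1 = 1 -> R x ->
    (forall z, R z -> R (conj_op x z)) -> (forall z, R z -> R (conj_op y z)) ->
  R y.
Proof.
move=> xx yy xy1 Rx Rxz Ryz.
have invE (z : 'M[k]_n.+1) : z * z = 1 -> invmx z = z.
  move=> zz; have uz : z \is a GRing.unit by apply/unitrP; exists z.
  by rewrite -[LHS]mulr1 -[in LHS]zz mulrA mulVr // mul1r.
rewrite -(expr_dihedral xx yy xy1).
elim: s {xy1} => [|s IHs]; first by rewrite mul1r.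
have := Rxz _ (Ryz _ IHs); rewrite /conj_op !invE // !mulmxE.
suff -> : x * (y * ((x * y) ^+ s.*2 * x) * y) * x = (x * y) ^+ s.+1.*2 * x by [].
by rewrite doubleS exprS exprSr !mulrA.
Qed.

(** * Matrices of rank at most one *)

Section RankOne.
Variables (k : fieldType) (n : nat).
Implicit Types A B : 'M[k]_n.

Lemma rank_le1P A : (\rank A <= 1)%N ->
  exists (v : 'cV[k]_n) (w : 'rV[k]_n), A = v *m w.
Proof.
move: (mulmx_base A); move: (col_base A) (row_base A).
case: (\rank A) => [|[|//]] v w <- _; last by exists v, w.
by exists 0, 0; rewrite [v]thinmx0 !mul0mx.
Qed.

(** For [A = v *m w], the inner factor [w *m B *m v] is a 1 by 1 matrix whose entry is the trace of
    [A *m B], by cyclicity. *)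
Lemma rank1_sandwich A B : (\rank A <= 1)%N ->
  A *m B *m A = \tr (A *m B) *: A.
Proof.
case/rank_le1P=> v [w ->].
rewrite -[v *m w *m B]mulmxA mxtrace_mulC trace_mx11.
rewrite -[LHS]mulmxA [(w *m B) *m _]mulmxA.
by rewrite {1}[w *m B *m v]mx11_scalar mul_scalar_mx -scalemxAr.
Qed.

(** For [A = v *m w] and [B = v' *m w'], the trace is the product of the scalars [w *m v'] and
    [w' *m v]; the first is a factor of [A *m B], the second of [B *m A]. *)
Lemma rank1_mulmx_eq0 A B : (\rank A <= 1)%N -> (\rank B <= 1)%N ->
  \tr (A *m B) = 0 -> A *m B = 0 \/ B *m A = 0.
Proof.
case/rank_le1P=> v [w ->] /rank_le1P[v' [w' ->]].
rewrite -[v *m w *m _]mulmxA -[v' *m w' *m _]mulmxA mxtrace_mulC.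
rewrite [w *m _]mulmxA [w' *m _]mulmxA.
rewrite [w *m v']mx11_scalar [w' *m v]mx11_scalar.
rewrite !mul_scalar_mx -scalemxAl mxtraceZ trace_mx11.
move/eqP; rewrite mulf_eq0 => /orP[] /eqP e; [left|right].
  by rewrite e scale0r mulmx0.
by rewrite e scale0r mulmx0.
Qed.

End RankOne.

(** [A * A = \tr A *: A], so each positive power of [A] is a power of [\tr A] times [A]; nilpotency
    leaves [\tr A = 0] or [A = 0]. *)
Lemma rank1_nilpotent_sqr (k : fieldType) n (A : 'M[k]_n.+1) m :
  (\rank A <= 1)%N -> A ^+ m = 0 -> A * A = 0.
Proof.
move=> rA Am0.
have AA : A * A = \tr A *: A.
  by have := rank1_sandwich 1%:M rA; rewrite !mulmx1.
case: m Am0 => [/eqP|m]; first by rewrite expr0 oner_eq0.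
have -> : A ^+ m.+1 = \tr A ^+ m *: A.
  elim: m => [|m IHm]; first by rewrite expr0 scale1r.
  by rewrite exprS IHm -scalerAr AA scalerA -exprSr.
move/eqP; rewrite scaler_eq0 expf_eq0 => /orP[/andP[_]|] /eqP A0.
  by rewrite AA A0 scale0r.
by rewrite A0 mul0r.
Qed.

(** * Transvections: Jordan type and order of products *)

(** The last row of the difference is zero. *)
Lemma rank_jordan_block_sub1 (k : fieldType) m :
  (\rank (jordan_block 1 m - 1%:M : 'M[k]_m)%R <= m.-1)%N.
Proof.
case: m => [|m] /=; first by rewrite leqn0 mxrank_eq0; apply/eqP/matrixP => -[].
have /mulmx0_rank_max : delta_mx (0 : 'I_1) ord_max *m
    (jordan_block 1 m.+1 - 1%:M : 'M[k]_m.+1) = 0.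
  rewrite -rowE; apply/rowP=> j; rewrite !mxE gtn_eqF ?ltn_ord //.
  by rewrite addr0 subrr.
by rewrite mxrank_delta.
Qed.

Lemma rank_unipotent_jordan_sub1 (k : fieldType) n (lam : seq nat)
    (e : (\sum_(i < size lam) nth 0 lam i)%N = n) :
  (\rank (castmx (e, e) (unipotent_jordan_mx k lam) - 1%:M)%R
     <= \sum_(i < size lam) (nth 0 lam i).-1)%N.
Proof.
case: _ / e; rewrite castmx_id -mxdiagZ -mxdiagB rank_mxdiag.
by apply: leq_sum => i _; apply: rank_jordan_block_sub1.
Qed.

Lemma rank_transvection_sub1 (k : fieldType) n (x : 'M[k]_n) a :
  has_partition x (2 :: nseq a 1)%N -> (\rank (x - 1%:M)%R <= 1)%N.
Proof.
case=> _ _ [e [P [uP ->]]].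
have -> (U : 'M[k]_n) : P *m U *m invmx P - 1%:M = P *m (U - 1%:M) *m invmx P.
  by rewrite mulmxBr mulmxBl mulmx1 mulmxV.
apply: leq_trans (mxrankM_maxl _ _) _; apply: leq_trans (mxrankM_maxr _ _) _.
apply: leq_trans (rank_unipotent_jordan_sub1 k e) _.
(* Only the block of size 2 contributes to the sum. *)
rewrite big_ord_recl big1 // => i _ /=.
by rewrite nth_nseq; case: ifP.
Qed.

(* With [C = xy - 1] and [t = tr AB], one has [C^3 = t C^2 + t C], so that the
   eigenvalues of [xy] are [1] and the roots [l], [1/l] of [X^2 - (2 + t) X + 1];
   when these are distinct, [xy] is diagonalizable. *)
Lemma transvection_prod_order (k : fieldType) n (A B : 'M[k]_n.+1) (l : k) m :
    (\rank A <= 1)%N -> (\rank B <= 1)%N -> A * A = 0 -> B * B = 0 ->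
    l != 0 -> l ^+ 2 != 1 -> l + l^-1 = 2 + \tr (A *m B) -> l ^+ m = 1 ->
  ((1 + A) * (1 + B)) ^+ m = 1.
Proof.
move=> rA rB AA BB l0 l2 ltr lm; set t := \tr (A *m B) in ltr.
have ABA : A * B * A = t *: A by apply: rank1_sandwich.
have BAB : B * A * B = t *: B.
  by rewrite [t]mxtrace_mulC; apply: rank1_sandwich.
pose C := A + B + A * B.
have -> : (1 + A) * (1 + B) = C + 1.
  by rewrite mulrDl mul1r mulrDr mulr1 !addrA [LHS](ACl (3 * 2 * 4 * 1)).
have AC : A * C = A * B by rewrite !mulrDr mulrA AA mul0r add0r addr0.
have BC : B * C = B * A + t *: B by rewrite !mulrDr mulrA BAB BB addr0.
have CE : C * (A * B + B * A) = t *: C.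
  have -> : C * (A * B + B * A) = A * (A * B + B * A)
      + B * (A * B + B * A) + A * (B * (A * B + B * A)).
    by rewrite [A * (B * _)]mulrA -!mulrDl.
  rewrite !mulrDr !mulrA -(mulrA A B B) AA BB ABA BAB mulr0 !mul0r !add0r !addr0.
  by rewrite -scalerAl -!scalerDr.
have CC : C * C = t *: C + (A * B + B * A).
  have -> : C * C = A * C + B * C + A * (B * C).
    by rewrite mulrA -!mulrDl.
  rewrite AC BC mulrDr mulrA ABA -scalerAr /C !scalerDr.
  by rewrite !addrA [LHS](ACl (4 * 3 * 5 * 1 * 2)).
(* The goal says that [Q] vanishes at [C]. The roots of [P] are 1, [l] and [l^-1] shifted down by 1;
   [P] annihilates [C], and it divides [Q] because these roots are distinct and [l ^+ m = 1]. *)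
pose Q : {poly k} := ('X + 1) ^+ m - 1.
pose P : {poly k} := \prod_(z <- [:: 0; l - 1; l^-1 - 1]) ('X - z%:P).
have PE : P = 'X * ('X * 'X) - t *: ('X * 'X) - t *: 'X.
  rewrite /P !big_cons big_nil mulr1 subr0 !polyCB.
  have ll : l%:P * (l^-1)%:P = 1 by rewrite -polyCM divff.
  have tE : t%:P = l%:P + (l^-1)%:P - 2 :> {poly k}.
    by rewrite -polyCD ltr polyCD polyC_natr addrAC subrr add0r.
  rewrite -!mul_polyC tE.
  set a := l%:P in ll *; set b := (l^-1)%:P in ll *.
  have -> : ('X - (a - 1)) * ('X - (b - 1)) =
    'X^2 - (a + b - 2) * 'X + (a * b + 1 - a - b) :> {poly k} by ring.
  by rewrite ll; ring.
have PC : horner_mx C P = 0.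
  rewrite PE -!mul_polyC !rmorphB !rmorphM /= horner_mx_X horner_mx_C.
  rewrite -!mulmxE !mul_scalar_mx !mulmxE.
  by rewrite [X in C * X]CC mulrDr CE -scalerAr addrAC addrK subrr.
have PQ : P %| Q.
  apply: uniq_roots_dvdp; rewrite ?uniq_rootsE /=.
    rewrite !rootE !hornerE /= !subrK lm exprVn lm.
    by rewrite invr1 !expr1n subrr eqxx.
  rewrite !inE !negb_or !andbT ![0 == _]eq_sym !subr_eq0.
  rewrite invr_eq1 (inj_eq (addIr _)).
  have l1 : l != 1 by apply: contra l2 => /eqP ->; rewrite expr1n.
  by rewrite l1; apply: contra l2 => /eqP lV; rewrite expr2 {2}lV divff.
have : horner_mx C Q = 0.
  by case/dvdpP: PQ => U ->; rewrite rmorphM /= PC mulr0.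
rewrite rmorphB rmorphXn rmorphD /= horner_mx_X rmorph1.
by move/eqP; rewrite subr_eq0 => /eqP.
Qed.

(** The proof that [q] is a power of the characteristic is an argument, so that a ring morphism
    structure can be attached to the map. *)
Definition frobq (k : fieldType) q & [pchar k].-nat q := fun a : k => a ^+ q.

(** * Hermitian adjoints and the special unitary group *)

Section Unitary.
Variables (k : fieldType) (q : nat) (qk : [pchar k].-nat q).

Local Notation phi := (frobq qk).

Fact frobq_is_zmod_morphism : zmod_morphism phi.
Proof.
move=> a b; rewrite /frobq exprDn_pchar //; congr (_ + _).
(* That [q]-th powers commute with opposites follows from additivity at [- b + b], whatever the
   parity of [q]; [q > 0] makes [0 ^+ q] vanish. *)
have /andP[q_gt0 _] := qk.
apply/eqP; rewrite -addr_eq0 -exprDn_pchar // addNr expr0n.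
by rewrite -(prednK q_gt0).
Qed.

Fact frobq_is_monoid_morphism : monoid_morphism phi.
Proof. by split=> [|a b]; rewrite /frobq ?expr1n // exprMn. Qed.

HB.instance Definition _ :=
  GRing.isZmodMorphism.Build k k phi frobq_is_zmod_morphism.
HB.instance Definition _ :=
  GRing.isMonoidMorphism.Build k k phi frobq_is_monoid_morphism.

Variable n : nat.
Implicit Types x y : 'M[k]_n.+1.

Lemma antidiag_mxK : antidiag_mx k n.+1 * antidiag_mx k n.+1 = 1.
Proof.
apply/matrixP=> i j; rewrite !mxE (bigD1 (rev_ord i)) //= !mxE eqxx mul1r.
rewrite big1 ?addr0 => [|l /negbTE il]; first by rewrite rev_ordK eq_sym.
by rewrite !mxE il mul0r.
Qed.

(** The adjoint for the sesquilinear form sending [v], [w] to [phi(v)^T J w], with [J] the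
    antidiagonal matrix. Applied twice it gives the Frobenius map of exponent [q * q], in general
    not the identity. *)
Definition herm_adj x : 'M[k]_n.+1 :=
  antidiag_mx k n.+1 * (map_mx phi x)^T * antidiag_mx k n.+1.

Lemma herm_adjD x y : herm_adj (x + y) = herm_adj x + herm_adj y.
Proof. by rewrite /herm_adj map_mxD linearD mulrDr mulrDl. Qed.

Lemma herm_adjM x y : herm_adj (x * y) = herm_adj y * herm_adj x.
Proof.
rewrite /herm_adj map_mxM trmx_mul -!mulrA; congr (_ * (_ * _)).
by rewrite [RHS]mulrA antidiag_mxK mul1r.
Qed.

Lemma herm_adj0 : herm_adj 0 = 0.
Proof. by rewrite /herm_adj map_mx0 trmx0 mulr0 mul0r. Qed.

Lemma herm_adj1 : herm_adj 1 = 1.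
Proof. by rewrite /herm_adj map_mx1 trmx1 mulr1 antidiag_mxK. Qed.

Lemma mxtrace_herm_adj x : \tr (herm_adj x) = (\tr x) ^+ q.
Proof.
rewrite /herm_adj -mulmxE mxtrace_mulC mulmxA mulmxE antidiag_mxK mul1r.
by rewrite mxtrace_tr -[RHS]/(phi (\tr x)) -trace_map_mx.
Qed.

(** The Steinberg map sends [x] to the adjoint of [x^-1], which is inverse to [herm_adj x] because
    the adjoint reverses products. *)
Lemma SU_herm_adjP x : SU q x <-> \det x = 1 /\ x * herm_adj x = 1.
Proof.
have -> : SU q x = (\det x = 1 /\ herm_adj x^-1 = x).
  rewrite /SU /= /Steinberg_SU -[Frob_mx q x]/(map_mx phi x).
  by rewrite -map_invmx !mulmxE.
have Vadj : \det x = 1 -> herm_adj x^-1 * herm_adj x = 1.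
  move=> dx; rewrite -herm_adjM divrr ?herm_adj1 //.
  by rewrite -[_ \is a _]/(x \in unitmx) unitmxE dx unitr1.
split=> -[dx] xE; split=> //; first by rewrite -[X in X * _]xE Vadj.
by rewrite -[LHS]mulr1 -[1](mulmx1C xE) mulmxE mulrA Vadj // mul1r.
Qed.

Lemma SU_unit x : SU q x -> x \is a GRing.unit.
Proof. by case=> dx _; rewrite -[_ \is a _]/(x \in unitmx) unitmxE dx unitr1. Qed.

Lemma SU_mul x y : SU q x -> SU q y -> SU q (x * y).
Proof.
rewrite !SU_herm_adjP => -[dx xE] [dy yE]; split.
  by rewrite -mulmxE det_mulmx dx dy mulr1.
by rewrite herm_adjM mulrA -(mulrA x) yE mulr1.
Qed.

Lemma SU_inv x : SU q x -> SU q x^-1.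
Proof.
move=> SUx; have ux := SU_unit SUx.
move: SUx; rewrite !SU_herm_adjP => -[dx xE]; split.
  by rewrite -[x^-1]/(invmx x) det_inv dx invr1.
have -> : x^-1 = herm_adj x by rewrite -[LHS]mulr1 -xE mulKr.
by rewrite -herm_adjM -mulmxE (mulmx1C xE) herm_adj1.
Qed.

Lemma is_rack_conjugacy_class (O : set 'M[k]_n.+1) :
  conjugacy_class (SU q) O -> is_rack (@conj_op k n.+1) O.
Proof.
case=> x SUx OE.
have opE y z : conj_op y z = y * z / y by [].
have OSU y : O y -> SU q y.
  rewrite OE => -[g SUg <-]; rewrite opE.
  by apply: SU_mul; [apply: SU_mul|apply: SU_inv].
have Oconj g y : SU q g -> O y -> O (g * y / g).
  rewrite OE => SUg [h SUh <-]; exists (g * h); first exact: SU_mul.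
  by rewrite !opE invrM ?SU_unit // !mulrA.
split.
- by exists (conj_op x x); rewrite OE; exists x.
- move=> a b c /OSU/SU_unit ua /OSU/SU_unit ub _; rewrite !opE.
  have uab : a * b \is a GRing.unit by rewrite unitrMl.
  rewrite invrM ?unitrV // (invrM ua) // invrK.
  by rewrite !mulrA !mulrVK.
- move=> a Oa; have SUa := OSU a Oa; have ua := SU_unit SUa; split.
  + by move=> b; apply: Oconj.
  + have uaV : a^-1 \is a GRing.unit by rewrite unitrV.
    by move=> b c _ _; rewrite !opE => /(mulIr uaV) /(mulrI ua).
  + move=> b Ob; exists (a^-1 * b * a); last by rewrite opE !mulrA mulrV // mul1r mulrK //.
    by rewrite -{2}[a]invrK; apply: Oconj => //; apply: SU_inv.
Qed.

Hypothesis k2 : 2 \in [pchar k].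

(** In characteristic 2, [(x - 1) * (x - 1) = x * x + 1], so [x] is an involution and
    [herm_adj x = x^-1 = x]. *)
Lemma transvection_sqr_herm_adj x : SU q x -> (x - 1) * (x - 1) = 0 ->
  x * x = 1 /\ herm_adj (x - 1) = x - 1.
Proof.
have M2 : 2 \in [pchar 'M[k]_n.+1].
  by rewrite (rmorph_pchar (@scalar_mx k n.+1)).
move=> SUx; have ux := SU_unit SUx.
rewrite !(oppr_pchar2 M2) mulrDl mul1r mulrDr mulr1 addrA -(addrA _ x x).
rewrite (addrr_pchar2 M2) addr0 => /eqP; rewrite addr_eq0 (oppr_pchar2 M2).
move/eqP=> xx; split=> //.
rewrite herm_adjD herm_adj1; congr (_ + _).
case/SU_herm_adjP: SUx => _ xE.
by rewrite -[LHS]mul1r -xx -mulrA xE mulr1.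
Qed.

End Unitary.

(** * Odd order of products in the unitary group, and the conclusion *)

Lemma SU_transvection_prod_odd_order (k : closedFieldType) q
    (qk : [pchar k].-nat q) n (x y : 'M[k]_n.+1) :
    2 \in [pchar k] -> ~~ odd q -> SU q x -> SU q y ->
    (\rank (x - 1)%R <= 1)%N -> (\rank (y - 1)%R <= 1)%N ->
    (x - 1) * (x - 1) = 0 -> (y - 1) * (y - 1) = 0 -> x * y <> y * x ->
  exists s, (x * y) ^+ s.*2.+1 = 1.
Proof.
move=> k2 q_even SUx SUy; set A := x - 1; set B := y - 1 => rA rB AA BB xy.
have adjA : herm_adj qk A = A.
  by have [] := transvection_sqr_herm_adj qk k2 SUx AA.
have adjB : herm_adj qk B = B.
  by have [] := transvection_sqr_herm_adj qk k2 SUy BB.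
have xE : x = 1 + A by rewrite addrC subrK.
have yE : y = 1 + B by rewrite addrC subrK.
clearbody A B.
have adjAB : herm_adj qk (A * B) = B * A by rewrite herm_adjM adjA adjB.
have adjBA : herm_adj qk (B * A) = A * B by rewrite herm_adjM adjA adjB.
set t := \tr (A *m B).
have t0 : t != 0.
  apply/eqP=> /(rank1_mulmx_eq0 rA rB) AB0; apply: xy.
  suff [AB BA] : A * B = 0 /\ B * A = 0.
    by rewrite xE yE !mulrDl !mulrDr !mul1r !mulr1 AB BA !addr0 addrAC.
  case: AB0; rewrite mulmxE => e; split=> //.
    by rewrite -adjAB e herm_adj0.
  by rewrite -adjBA e herm_adj0.
(* The adjoint raises traces to the power [q], and it turns [A * B] into [B * A], which has the same
   trace. *)
have tq : t ^+ q = t.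
  rewrite -(mxtrace_herm_adj qk) mulmxE adjAB.
  exact: mxtrace_mulC.
have two0 : 2 = 0 :> k by apply: pcharf0 k2.
(* The roots of [p] are inverse to each other with sum [2 + t], the form expected by
   [transvection_prod_order]. *)
pose p : {poly k} := 'X * 'X - (2 + t) *: 'X + 1.
have rootp z : root p z = (z * z - (2 + t) * z + 1 == 0).
  by rewrite rootE /p !hornerE.
have [l] : exists l, root p l.
  apply/closed_rootP; rewrite /p -addrA size_polyDl -expr2 size_polyXn //.
  rewrite (leq_ltn_trans (size_polyD _ _)) // size_polyN gtn_max size_poly1 andbT.
  by rewrite (leq_ltn_trans (size_scale_leq _ _)) ?size_polyX.
rewrite rootp => /eqP pl.
have l0 : l != 0.
  by apply: contra_eq_neq pl => ->; rewrite !mulr0 subr0 add0r oner_neq0.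
have lE : l + l^-1 = 2 + t.
  apply: (mulIf l0); rewrite mulrDl mulVf //.
  by apply/eqP; rewrite -subr_eq0 -[X in _ == X]pl; apply/eqP; ring.
(* If [l ^+ 2 = 1], then [l^-1 = l] and [t = l + l = 0] in characteristic 2. *)
have l2 : l ^+ 2 != 1.
  apply: contra t0 => /eqP ll.
  have lV : l^-1 = l by apply: (mulIf l0); rewrite mulVf // -expr2.
  by move: lE; rewrite lV two0 add0r -mulr2n -mulr_natr two0 mulr0 => <-.
(* The Frobenius map fixes the coefficients of [p], so [l ^+ q] is again a root: [l] or [l^-1].
   Either way, a second application returns [l]. *)
have lqq : l ^+ (q * q) = l.
  have := congr1 (frobq qk) pl.
  rewrite rmorphD rmorphB !rmorphM rmorphD rmorph1 rmorph0 rmorph_nat.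
  rewrite /= -[frobq qk t]/(t ^+ q) tq -lE; set a := frobq qk l => pa.
  have : (a - l) * (a - l^-1) = 0.
    by rewrite -pa -(mulfV l0); ring.
  have aq : l ^+ q = a by [].
  move/eqP; rewrite mulf_eq0 !subr_eq0 exprM aq => /orP[] /eqP al.
    by rewrite al aq al.
  by rewrite al exprVn aq al invrK.
have qq_gt0 : (0 < q * q)%N by have /andP[q_gt0 _] := qk; rewrite muln_gt0 q_gt0.
(* [q * q] is even and positive, so its predecessor is odd. *)
have [s qq] : exists s, (q * q).-1 = s.*2.+1.
  exists (q * q).-1./2; rewrite -[LHS]odd_double_half.
  have : ~~ odd (q * q) by rewrite oddM negb_and q_even.
  by case: (q * q)%N qq_gt0 => //= m _; rewrite negbK => ->.
exists s; rewrite xE yE -qq; apply: (transvection_prod_order rA rB AA BB l0 l2 lE).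
by apply: (mulIf l0); rewrite mul1r -exprSr prednK.
Qed.

Theorem lemma5p16 (q : nat) (Fq : finFieldType) (k : closedFieldType)
    (iota : {rmorphism Fq -> k}) (n : nat) (O : set 'M[k]_n) :
  #|Fq| = q -> is_algebraic_closure iota ->
  ~~ odd q -> (3 <= n)%N ->
  unipotent_class_with_partition (@SU k n q) O (2%N :: nseq (n - 2) 1%N) ->
  austere (@conj_op k n) O /\ kthulhu (@conj_op k n) O.
Proof.
move=> cardF _ q_even; case: n O => [//|n] O _ [classO unipO].
(* [q] is a power of the characteristic of [Fq]; being even, it forces this to be 2, and [iota]
   carries the characteristic over to [k]. *)
have [p p_pr pF] := finPcharP Fq.
have qE := card_pprimeChar pF.
rewrite cardF in qE.
have pk : p \in [pchar k] by apply: rmorph_pchar pF.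
have p2 : p = 2%N.
  case: (even_prime p_pr) => // p_odd.
  by move: q_even; rewrite qE oddX p_odd orbT.
have k2 : 2%N \in [pchar k] by rewrite -p2.
have qk : [pchar k].-nat q by rewrite qE pnatX pnatE // pk.
have rackO := is_rack_conjugacy_class qk classO.
have OSU x : O x -> SU q x.
  case: classO => z SUz ->  [g SUg <-].
  exact: (SU_mul qk (SU_mul qk SUg SUz) (SU_inv qk SUg)).
have rO x : O x -> (\rank (x - 1)%R <= 1)%N.
  by case/unipO=> _; apply: rank_transvection_sub1.
have O0 x : O x -> (x - 1) * (x - 1) = 0.
  move=> Ox; have [[m xm] _] := unipO x Ox.
  exact: rank1_nilpotent_sqr (rO x Ox) xm.
have O1 x : O x -> x * x = 1.
  by move=> Ox; case: (transvection_sqr_herm_adj qk k2 (OSU x Ox) (O0 x Ox)).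
have uO x : O x -> x \is a GRing.unit by move=> /OSU; apply: SU_unit.
have fixP x y : O x -> conj_op x y = y <-> x * y = y * x.
  move=> /uO ux; rewrite /conj_op mulmxE -[invmx x]/(x^-1); split=> [e|->].
    by rewrite -{2}e mulrVK.
  by rewrite mulrK.
have op_id x : O x -> conj_op x x = x by move=> Ox; apply/fixP.
have op_sym x y : O x -> O y -> conj_op x y = y -> conj_op y x = x.
  by move=> Ox Oy /fixP-/(_ Ox) xy; apply/fixP.
have linkO x y : O x -> O y -> conj_op x y <> y -> forall R : set 'M[k]_n.+1,
    R x -> (forall z, R z -> R (conj_op x z)) ->
    (forall z, R z -> R (conj_op y z)) -> R y.
  move=> Ox Oy xy R; have [] // := @SU_transvection_prod_odd_order k q qk n x y.
  - exact: OSU.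
  - exact: OSU.
  - exact: rO.
  - exact: rO.
  - exact: O0.
  - exact: O0.
  - by move=> e; apply/xy/fixP.
  by move=> s xy1; apply: conj_linked xy1; apply: O1.
split; first exact: linked_austere.
exact: linked_kthulhu.
Qed.
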